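(* Let $P,Q\in\mathbb{Z}\setminus\{0\}$ be such that $D=P^2-4Q\neq 0$ and the Lucas sequences $U=U(P,Q)$, $V=V(P,Q)$ are nondegenerate. Let $M^U$ be the Möbius dual of $U$, let $p$ be a prime, and let $n\ge 1$ be an integer. If $p\nmid \gcd(P,Q)$, we have the following cases. (a) If $p\mid Q$, then $v_p(M^U_n)=0$ for all $n\ge 1$. (b) If $p\mid D$, then $$v_p(M^U_n)=\begin{cases} v_p(U_p), & \text{if } n=p,\\ 1, & \text{if } n=p^k,\ k>1,\\ 0, & \text{otherwise}.\end{cases}$$ (c) If $p\nmid QD$, then $$v_p(M^U_n)=\begin{cases} v_p(U_{z_U(p)}), & \text{if } n=z_U(p),\\ v_p(U_{p z_U(p)})-v_p(U_{z_U(p)}), & \text{if } n=p\,z_U(p),\\ 1, & \text{if } n=p^k z_U(p),\ k>1,\\ 0, & \text{otherwise}.\end{cases}$$ If $p\mid \gcd(P,Q)$, then we have the following cases. (d) If $v_p(Q)\ge 2v_p(P)$, then $$v_p(M^U_n)=\begin{cases} 0, & \text{if } n=1,\\ \varphi(n)v_p(P)+v_p\bigl(M^{U^{(p)}}_n\bigr), & \text{if } n>1,\end{cases}$$ where $U^{(p)}=U\bigl(\partial_p(P),\partial_p(Q)\bigr)$. (e) If $2v_p(P)>v_p(Q)$, then $$v_p(M^U_n)=\begin{cases} v_p(P), & \text{if } n=2,\\ (\varphi(n)/2)\,v_p(Q)+1, & \text{if } n=2p^k,\ k\ge 1,\\ \lfloor \varphi(n)/2\rfloor\, v_p(Q), &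 \text{otherwise},\end{cases}$$ unless $2v_p(P)=v_p(Q)+1$, $p=2$ or $3$, and $n=2p$, in which case $$v_p(M^U_{2p})=v_p(Q)+1+v_p\bigl(\partial_p(P)^2-\partial_p(Q)\bigr).$$
   Context: For $P,Q\in\mathbb{Z}\setminus\{0\}$ with $D=P^2-4Q\ne 0$, let $\alpha=\frac{P+\sqrt D}{2}$, $\beta=\frac{P-\sqrt D}{2}$ be the roots of $X^2-PX+Q$. The Lucas sequences of the first and second kind are the integer sequences $U(P,Q)=(U_n)_{n\ge 0}$ and $V(P,Q)=(V_n)_{n\ge 0}$ given by $U_n=\frac{\alpha^n-\beta^n}{\alpha-\beta}$ and $V_n=\alpha^n+\beta^n$. They are called nondegenerate if $U_n\ne 0$ and $V_n\neq 0$ for all $n\ge 1$ (equivalently, $\alpha/\beta$ is not a root of unity). It is not assumed that $\gcd(P,Q)=1$. For a sequence $A=(A_n)_{n\ge 1}$ of nonzero integers, its Möbius dual $M^A=(M^A_n)_{n\ge 1}$ is the sequence of rational numbers $M^A_n=\prod_{d\mid n}A_d^{\mu(n/d)}$, where $\mu$ is the Möbius function. $v_p$ is the $p$-adic valuation on $\mathbb{Q}$, $\varphi$ is Euler's totient function, and $\partial_p(m)=m/p^{v_p(m)}$ is the $p$-free part of a nonzero integer $m$. The entry point (rank of apparition) of a prime $p$ in $U$ is $z_U(p)=\min\{n\ge 1: p\mid U_n\}$; it exists except when $p\nmid P$ and $p\mid Q$.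
   Formalization: In (d), U^(p) is taken as U(∂_p(P), Q/p^{2v_p(P)}) instead of U(∂_p(P), ∂_p(Q)); the two agree when v_p(Q)=2v_p(P), and the original fails when v_p(Q)>2v_p(P), e.g. P=3, Q=-27, p=3, n=4 (valuation 2, not 3). *)

(* Defs.v *)
From mathcomp Require Import all_boot all_order all_algebra all_field.
From mathcomp Require Import ring.
From mathcomp Require Import boolp.

Set Implicit Arguments.
Unset Strict Implicit.
Unset Printing Implicit Defensive.

Import Order.TTheory GRing.Theory Num.Theory.
Local Open Scope ring_scope.

Definition lucas_disc (P Q : int) : int := P ^+ 2 - 4 * Q.

Definition lucas_alpha (P Q : int) : algC :=
  (P%:~R + sqrtC (lucas_disc P Q)%:~R) / 2.

Definition lucas_beta (P Q : int) : algC :=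
  (P%:~R - sqrtC (lucas_disc P Q)%:~R) / 2.

(* The Binet quotients are integers when the discriminant is nonzero, so
   Num.floor only changes the type from algC to int: see lucasU_binet and
   lucasV_binet. *)
Definition lucasU (P Q : int) (n : nat) : int :=
  Num.floor ((lucas_alpha P Q ^+ n - lucas_beta P Q ^+ n)
             / (lucas_alpha P Q - lucas_beta P Q)).

Definition lucasV (P Q : int) (n : nat) : int :=
  Num.floor (lucas_alpha P Q ^+ n + lucas_beta P Q ^+ n).

Definition lucas_nondegenerate (P Q : int) : Prop :=
  forall n : nat, (0 < n)%N -> lucasU P Q n != 0 /\ lucasV P Q n != 0.

Definition moebius (n : nat) : int :=
  if all (fun q => logn q n == 1) (primes n) then (-1) ^+ size (primes n)
  else 0.

Definition moebius_dual (A : nat -> int) (n : nat) : rat :=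
  \prod_(d <- divisors n) (A d)%:Q ^ moebius (n %/ d).

(* Junk value at 0: vp p 0 = 0. *)
Definition vp (p : nat) (x : rat) : int :=
  (logn p `|numq x|)%:Z - (logn p `|denq x|)%:Z.

Definition pfree (p : nat) (m : int) : int :=
  (m %/ (p ^ logn p `|m|)%:Z)%Z.

(* Takes the value 0 when p divides no A n with n >= 1. *)
Definition entry_point (A : nat -> int) (p : nat) : nat :=
  if pselect (exists n : nat, (0 < n)%N && (p%:Z %| A n)%Z) is left ex
  then ex_minn ex else 0.

(* The sequence U^(p) such that, when v_p(Q) >= 2 v_p(P),
     U_n(P, Q) = p ^ ((n - 1) v_p(P)) * U^(p)_n.
   Its second parameter is Q / p ^ (2 v_p(P)), which is the p-free part of Q
   exactly when v_p(Q) = 2 v_p(P) (lucasU_red_pfree).  If v_p(Q) > 2 v_p(P),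
   the p-free part of Q is not the right parameter: for P = 3, Q = -27, p = 3
   one has M^U_4 = U_4 / U_2 = 63, of valuation 2 = phi(4) v_3(P), whereas
   U(1, -1) is the Fibonacci sequence, with U_4 / U_2 = 3. *)
Definition lucasU_red (p : nat) (P Q : int) : nat -> int :=
  lucasU (pfree p P) (Q %/ (p ^ (2 * logn p `|P|))%:Z)%Z.

Lemma lucasU_red_pfree (p : nat) (P Q : int) :
  logn p `|Q| = (2 * logn p `|P|)%N ->
  lucasU_red p P Q = lucasU (pfree p P) (pfree p Q).
Proof. by rewrite /lucasU_red /pfree => ->. Qed.

Lemma vp_int (p : nat) (m : int) : vp p m%:Q = (logn p `|m|)%:Z.
Proof. by rewrite /vp numq_int denq_int logn1 subr0. Qed.

Lemma pfreeK (p : nat) (m : int) :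
  pfree p m * (p ^ logn p `|m|)%:Z = m.
Proof. by apply/divzK; rewrite dvdzE /= pfactor_dvdnn. Qed.

Lemma lucas_alphaDbeta (P Q : int) :
  lucas_alpha P Q + lucas_beta P Q = P%:~R.
Proof. by rewrite /lucas_alpha /lucas_beta; field. Qed.

Lemma lucas_alphaMbeta (P Q : int) :
  lucas_alpha P Q * lucas_beta P Q = Q%:~R.
Proof.
rewrite /lucas_alpha /lucas_beta.
set s := sqrtC _; have sE : s ^+ 2 = P%:~R ^+ 2 - 4 * Q%:~R.
  by rewrite sqrtCK /lucas_disc intrD mulrNz intrM expr2 intrM.
transitivity ((P%:~R ^+ 2 - s ^+ 2) / 4 : algC); first by field.
by rewrite sE; field.
Qed.

Lemma lucas_alphaBbeta_neq0 (P Q : int) :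
  lucas_disc P Q != 0 -> lucas_alpha P Q - lucas_beta P Q != 0.
Proof.
move=> D0; have -> : lucas_alpha P Q - lucas_beta P Q
    = sqrtC (lucas_disc P Q)%:~R by rewrite /lucas_alpha /lucas_beta; field.
by rewrite sqrtC_eq0 intr_eq0.
Qed.

Fixpoint lucas_rec (P Q a b : int) (n : nat) : int :=
  if n is m.+1 then lucas_rec P Q b (P * b - Q * a) m else a.

Lemma lucas_recP (P Q a b : int) (c d : algC) (n : nat) :
  a%:~R = c + d -> b%:~R = c * lucas_alpha P Q + d * lucas_beta P Q ->
  (lucas_rec P Q a b n)%:~R
    = c * lucas_alpha P Q ^+ n + d * lucas_beta P Q ^+ n.
Proof.
elim: n a b c d => [|n IHn] a b c d aE bE; first by rewrite !expr0 !mulr1.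
rewrite /= (IHn _ _ (c * lucas_alpha P Q) (d * lucas_beta P Q)) //.
  by rewrite !exprS !mulrA.
rewrite rmorphB !rmorphM /= aE bE -(lucas_alphaDbeta P Q).
by rewrite -(lucas_alphaMbeta P Q); ring.
Qed.

Lemma lucasU_binet (P Q : int) (n : nat) : lucas_disc P Q != 0 ->
  (lucasU P Q n)%:~R = (lucas_alpha P Q ^+ n - lucas_beta P Q ^+ n)
                       / (lucas_alpha P Q - lucas_beta P Q).
Proof.
move=> /lucas_alphaBbeta_neq0 ab0; rewrite /lucasU.
set x := _ / _; suff -> : x = (lucas_rec P Q 0 1 n)%:~R by rewrite intrKfloor.
pose c := (lucas_alpha P Q - lucas_beta P Q)^-1.
rewrite (@lucas_recP _ _ _ _ c (- c)) ?subrr //.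
  by rewrite /x -/c; ring.
by rewrite mulNr -mulrBr mulVf.
Qed.

Lemma lucasV_binet (P Q : int) (n : nat) :
  (lucasV P Q n)%:~R = lucas_alpha P Q ^+ n + lucas_beta P Q ^+ n.
Proof.
rewrite /lucasV; set x := _ + _.
suff -> : x = (lucas_rec P Q 2 P n)%:~R by rewrite intrKfloor.
rewrite (@lucas_recP _ _ _ _ 1 1) ?mul1r //.
by rewrite lucas_alphaDbeta.
Qed.

(* Main.v *)
(* By Moebius inversion, if v_p(U_d) is F(k) for d = z p^k m with p not dividing
   m, and 0 when z does not divide d, then v_p(M^U_n) is F(k) - F(k-1) at
   n = z p^k and 0 elsewhere.  For p prime to Q such an F comes from
     U_{mk} = U_m U_k(V_m, Q^m),  V_m = 2 U_{m+1} - P U_m: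
   the discriminant of (V_m, Q^m) is D U_m^2, so modulo powers of p | U_m the
   second factor has a double root h and equals k h^(k-1).  When p divides
   gcd(P, Q), a power of p is factored out: of all U_n if v_p(Q) >= 2 v_p(P); of
   the bisections U_{2k} and U_{2k+1} otherwise, with x = P^2 / p^(v_p(Q)) and
   q = Q / p^(v_p(Q)) leaving U_{2k} as U_k(x - 2q, q^2), where p divides the
   discriminant x (x - 4q) but not q. *)

Require Import Defs.
From mathcomp Require Import all_boot all_order all_algebra all_field.
From mathcomp Require Import boolp cyclic ring zify.

Set Implicit Arguments.
Unset Strict Implicit.
Unset Printing Implicit Defensive.

Import Order.TTheory GRing.Theory Num.Theory.
Local Open Scope ring_scope.

(** * Divisor sums of the Moebius function *)

Lemma moebius1 : moebius 1 = 1.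
Proof. by []. Qed.

Lemma moebius_sq0 (p d : nat) :
  prime p -> (0 < d)%N -> (p ^ 2 %| d)%N -> moebius d = 0.
Proof.
move=> pp d0 pd; rewrite /moebius; case: ifP => // /allP/(_ p).
rewrite mem_primes pp d0 (dvdn_trans _ pd) ?expnS ?dvdn_mulr // => /(_ isT).
by move: pd; rewrite pfactor_dvdn // => + /eqP E; rewrite E.
Qed.

Lemma moebius_primeM (p d : nat) :
  prime p -> (0 < d)%N -> ~~ (p %| d)%N -> moebius (p * d) = - moebius d.
Proof.
move=> pp d0 pd; have p0 := prime_gt0 pp.
have perm : perm_eq (primes (p * d)) (p :: primes d).
  apply: uniq_perm; rewrite /= ?primes_uniq ?mem_primes ?(negPf pd) ?andbF //.
  by move=> q; rewrite inE primesM // (primes_prime pp) inE.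
rewrite /moebius (perm_all _ perm) (perm_size perm) /= exprS mulN1r.
have -> : logn p (p * d) = 1%N.
  rewrite lognM // (logn_prime _ pp) eqxx logn_coprime //.
  by rewrite prime_coprime.
rewrite eqxx /= (_ : all _ (primes d)
                = all (fun q => logn q d == 1%N) (primes d)).
  by case: ifP; rewrite ?oppr0.
apply: eq_in_all => q qd; rewrite lognM // (logn_prime _ pp).
case: (q =P p) => // qp; move: qd; rewrite qp mem_primes => /and3P[_ _].
by rewrite (negPf pd).
Qed.

(** Double sums over divisors of divisors can be exchanged only once the inner index runs over one
    fixed list. *)
Lemma sum_divisors_widen (t n : nat) (F : nat -> int) :
  (0 < n)%N -> (t %| n)%N ->
  \sum_(d <- divisors t) F d = \sum_(d <- divisors n | (d %| t)%N) F d.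
Proof.
move=> n0 tn; have t0 := dvdn_gt0 n0 tn.
rewrite -[RHS]big_filter; apply: perm_big; apply: uniq_perm.
- exact: divisors_uniq.
- exact/filter_uniq/divisors_uniq.
move=> d; rewrite mem_filter -!dvdn_divisors //.
by case dt: (d %| t)%N => //=; rewrite (dvdn_trans dt tn).
Qed.

Lemma sum_divisors_compl (n : nat) (F : nat -> int) : (0 < n)%N ->
  \sum_(d <- divisors n) F d = \sum_(d <- divisors n) F (n %/ d)%N.
Proof.
move=> n0; rewrite -[RHS](big_map (fun d => n %/ d)%N xpredT F).
apply: perm_big; apply: uniq_perm; first exact: divisors_uniq.
- rewrite map_inj_in_uniq ?divisors_uniq // => d e.
  rewrite -!dvdn_divisors // => /dvdnP[a nE] /dvdnP[b nE'].
  have d0 : (0 < d)%N by case: d nE n0 => // ->; rewrite muln0.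
  have e0 : (0 < e)%N by case: e nE' n0 => // ->; rewrite muln0.
  rewrite {1}nE mulnK // nE' mulnK // => ab; apply/eqP.
  have b0 : (0 < b)%N by case: (b) nE' n0 => // ->.
  by rewrite -(eqn_pmul2l b0) -{1}ab -nE -nE'.
move=> d; apply/idP/mapP => [|[e + ->]]; rewrite -!dvdn_divisors //; last first.
  by apply: dvdn_div.
move=> dn; exists (n %/ d)%N; first by rewrite -dvdn_divisors ?dvdn_div.
by rewrite divnA // mulKn.
Qed.

(** Let p be a prime factor of n and u the p-free part of n. Divisors divisible by p^2 contribute 0,
    and the divisors p * d with d | u cancel against the divisors d of u. *)
Lemma sum_moebius (n : nat) : (0 < n)%N ->
  \sum_(d <- divisors n) moebius d = (n == 1%N)%:R.
Proof.
move=> n0; case: eqP => [->|n1]; first by rewrite big_seq1 moebius1.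
have pp : prime (pdiv n) by apply: pdiv_prime; lia.
set p := pdiv n in pp; have p0 := prime_gt0 pp.
have pn : (p %| n)%N := pdiv_dvd n.
have [u pu nE] := pfactor_coprime pp n0.
have k0 : (0 < logn p n)%N by rewrite logn_gt0 mem_primes pp n0.
have u0 : (0 < u)%N by case: (u) nE n0 => // ->.
rewrite (bigID (fun d => p %| d)%N) /=.
have -> : \sum_(d <- divisors n | ~~ (p %| d)%N) moebius d
    = \sum_(d <- divisors u) moebius d.
  rewrite -[LHS]big_filter; apply: perm_big; apply: uniq_perm.
  - exact/filter_uniq/divisors_uniq.
  - exact: divisors_uniq.
  move=> d; rewrite mem_filter -!dvdn_divisors // nE.
  apply/andP/idP => [[pd]|du].
    by rewrite Gauss_dvdl // coprime_sym coprimeXl // prime_coprime.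
  split; last exact: dvdn_mulr.
  by apply: contraL pu => pd; rewrite prime_coprime // negbK (dvdn_trans pd).
rewrite (bigID (fun d => p ^ 2 %| d)%N) /=.
rewrite big_seq_cond big1 ?add0r => [|d /andP[dn /andP[_ ?]]]; last first.
  apply: (@moebius_sq0 p) => //; move: dn; rewrite -dvdn_divisors // => dn.
  exact: dvdn_gt0 dn.
suff -> : \sum_(d <- divisors n | (p %| d)%N && ~~ (p ^ 2 %| d)%N) moebius d
    = \sum_(d <- divisors u) moebius (p * d)%N.
  rewrite -big_split big_seq big1 //= => d.
  rewrite -dvdn_divisors // => du; rewrite moebius_primeM ?addNr //.
    exact: dvdn_gt0 du.
  by apply: contraL pu => pd; rewrite prime_coprime // negbK (dvdn_trans pd).
rewrite -[LHS]big_filter -[RHS](big_map (fun d => p * d)%N xpredT moebius).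
apply: perm_big; apply: uniq_perm.
- exact/filter_uniq/divisors_uniq.
- rewrite map_inj_uniq ?divisors_uniq // => d e /eqP.
  by rewrite eqn_pmul2l // => /eqP.
move=> d; rewrite mem_filter -!dvdn_divisors //.
apply/idP/mapP => [/andP[/andP[/dvdnP[e ->]]]|[e + ->]]; last first.
  rewrite -dvdn_divisors // dvdn_mulr //= expnS expn1 dvdn_pmul2l // => eu.
  rewrite [X in (p * e %| X)%N]nE -(prednK k0) expnS mulnCA dvdn_pmul2l //.
  rewrite dvdn_mulr // andbT.
  by apply: contraL pu => pd; rewrite prime_coprime // negbK (dvdn_trans pd).
rewrite expnS expn1 dvdn_pmul2r // => pe en; exists e; last by rewrite mulnC.
rewrite -dvdn_divisors //; move: en; rewrite nE => en.
have : (e %| u * p ^ logn p n)%N by apply: dvdn_trans en; apply: dvdn_mulr.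
by rewrite Gauss_dvdl // coprime_sym coprimeXl // prime_coprime.
Qed.

(** * The additive Moebius transform: inversion and explicit transforms *)

Definition moebius_transform (f : nat -> int) (n : nat) : int :=
  \sum_(d <- divisors n) moebius (n %/ d) * f d.

Lemma eq_moebius_transform (f g : nat -> int) (n : nat) : (0 < n)%N ->
  (forall d, (0 < d)%N -> f d = g d) ->
  moebius_transform f n = moebius_transform g n.
Proof.
move=> n0 fg; rewrite /moebius_transform [LHS]big_seq [RHS]big_seq.
apply: eq_bigr => d; rewrite -dvdn_divisors // => dn.
by rewrite fg // (dvdn_gt0 n0 dn).
Qed.

Lemma moebius_transformD (f g : nat -> int) (n : nat) :
  moebius_transform (fun d => f d + g d) n
  = moebius_transform f n + moebius_transform g n.
Proof.
rewrite /moebius_transform -big_split.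
by apply: eq_bigr => d _ /=; rewrite mulrDr.
Qed.

Lemma moebius_transformZ (c : int) (f : nat -> int) (n : nat) :
  moebius_transform (fun d => c * f d) n = c * moebius_transform f n.
Proof.
rewrite /moebius_transform mulr_sumr.
by apply: eq_bigr => d _ /=; rewrite mulrCA.
Qed.

(** After the sums are exchanged, g e is multiplied by the sum of [moebius (n %/ d)] over e | d | n.
    There n/d runs over the divisors of n/e, so only e = n survives. The transforms below are
    obtained by exhibiting g. *)
Lemma moebius_inversion (f g : nat -> int) (n : nat) : (0 < n)%N ->
  (forall d, (0 < d)%N -> f d = \sum_(e <- divisors d) g e) ->
  moebius_transform f n = g n.
Proof.
move=> n0 fE; rewrite /moebius_transform.
have -> : \sum_(d <- divisors n) moebius (n %/ d) * f d =
    \sum_(d <- divisors n) \sum_(e <- divisors n | (e %| d)%N)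
      moebius (n %/ d) * g e.
  rewrite [LHS]big_seq [RHS]big_seq; apply: eq_bigr => d.
  rewrite -dvdn_divisors // => dn; rewrite fE ?(dvdn_gt0 n0 dn) //.
  by rewrite (sum_divisors_widen _ n0 dn) mulr_sumr.
rewrite (exchange_big_dep xpredT) //=.
have inner e : (e %| n)%N ->
    \sum_(d <- divisors n | (e %| d)%N) moebius (n %/ d) * g e
    = (n == e)%:R * g e.
  move=> en; have e0 := dvdn_gt0 n0 en.
  rewrite -mulr_suml; congr (_ * _).
  transitivity (\sum_(d <- divisors (n %/ e)) moebius d); last first.
    rewrite sum_moebius; last by rewrite divn_gt0 // dvdn_leq.
    by rewrite [in LHS]eq_sym eqn_div // mul1n eq_sym.
  rewrite (sum_divisors_widen _ n0 (dvdn_div en)).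
  rewrite big_mkcond [RHS]big_mkcond /= [RHS]sum_divisors_compl //.
  rewrite [LHS]big_seq [RHS]big_seq; apply: eq_bigr => d.
  rewrite -dvdn_divisors // => dn.
  have d0 := dvdn_gt0 n0 dn.
  congr (if _ then _ else _); case/dvdnP: dn => a nE.
  move: en; rewrite nE mulnK // => en.
  have a0 : (0 < a)%N by case: (a) nE n0 => // ->.
  by rewrite dvdn_divRL // dvdn_pmul2l.
rewrite big_seq (eq_bigr (fun e => (n == e)%:R * g e)); last first.
  by move=> e; rewrite -dvdn_divisors //; apply: inner.
rewrite -big_seq (bigD1_seq n) ?divisors_id ?divisors_uniq //= eqxx mul1r.
by rewrite big1 ?addr0 // => e /negPf; rewrite eq_sym => ->; rewrite mul0r.
Qed.

Lemma sum_divisors_pred1 (m d : nat) (c : int) : (0 < d)%N ->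
  \sum_(e <- divisors d) (e == m)%:R * c = (m %| d)%N%:R * c.
Proof.
move=> d0; rewrite dvdn_divisors // -mulr_suml; congr (_ * _).
case md: (m \in divisors d).
  rewrite (bigD1_seq m) ?divisors_uniq //= eqxx big1 ?addr0 //.
  by move=> e /negPf ->.
by rewrite big_seq big1 // => e ed; case: eqP => // em; rewrite -em ed in md.
Qed.

Lemma moebius_transform_1 (n : nat) : (0 < n)%N ->
  moebius_transform (fun=> 1) n = (n == 1%N)%:R.
Proof.
move=> n0; apply: (@moebius_inversion _ (fun n => (n == 1%N)%:R)) => // d d0.
have := sum_divisors_pred1 1 1 d0; rewrite dvd1n mulr1 => E.
rewrite -[LHS]/(true%:R) -E.
by apply: eq_bigr => e _; rewrite mulr1.
Qed.

Lemma sum_divisors_totient (d : nat) : (0 < d)%N ->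
  \sum_(e <- divisors d) (totient e)%:Z = d%:Z.
Proof.
move=> d0; transitivity ((\sum_(e <- divisors d) totient e)%N%:R : int).
  by rewrite natr_sum; apply: eq_bigr => e _; rewrite natz.
rewrite natz -[in RHS](sum_totient_dvd d); congr Posz.
rewrite -(big_mkord (fun e => e %| d)%N) -[RHS]big_filter.
apply: perm_big; apply: uniq_perm; first exact: divisors_uniq.
  exact/filter_uniq/iota_uniq.
move=> e; rewrite mem_filter mem_index_iota -dvdn_divisors //=.
by case ed: (e %| d)%N => //=; rewrite ltnS dvdn_leq.
Qed.

Lemma moebius_transform_id (n : nat) : (0 < n)%N ->
  moebius_transform (fun d => d%:Z) n = totient n.
Proof.
move=> n0; apply: (@moebius_inversion _ (fun n => (totient n)%:Z)) => // d d0.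
by rewrite sum_divisors_totient.
Qed.

(** The square of n - 1 is 1 modulo n, so an odd exponent phi(n) in Euler's theorem would give n - 1
    = 1 modulo n. *)
Lemma totient_even (n : nat) : (2 < n)%N -> ~~ odd (totient n).
Proof.
move=> n2; apply/negP => odd_phi; have n0 : (0 < n)%N by lia.
have cop : coprime n.-1 n by rewrite coprimePn.
have := Euler_exp_totient cop.
rewrite -[totient n]odd_double_half odd_phi add1n expnS -mul2n expnM.
have sq : (n.-1 ^ 2 = 1 %[mod n])%N.
  have -> : (n.-1 ^ 2 = (n - 2) * n + 1)%N.
    by case: (n) n2 => [|[|m]] // _; rewrite /= !subSS subn0; lia.
  by rewrite modnMDl.
rewrite -modnMmr -modnXm sq modnXm exp1n modnMmr muln1 !modn_small //; lia.
Qed.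

(** The floor of (d - 1)/2 is the exponent of the common factor split off from the bisections of U.
    Since phi(e) is odd only at e = 1 and e = 2, summing 2 floor(phi(e)/2) over e | d gives d - 1,
    less 1 more if d is even, which is 2 floor((d - 1)/2). *)
Lemma moebius_transform_half (n : nat) : (0 < n)%N ->
  moebius_transform (fun d => (d.-1 %/ 2)%N%:Z) n = (totient n %/ 2)%N%:Z.
Proof.
move=> n0.
apply: (@moebius_inversion _ (fun n => (totient n %/ 2)%N%:Z)) => // d d0.
apply: (@mulfI _ 2) => //; rewrite mulr_sumr.
have -> : \sum_(e <- divisors d) 2 * (totient e %/ 2)%N%:Z =
    \sum_(e <- divisors d) ((totient e)%:Z + (e == 1%N)%:R * (-1)
                            + (e == 2)%:R * (-1)).
  rewrite [LHS]big_seq [RHS]big_seq; apply: eq_bigr => e.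
  rewrite -dvdn_divisors // => /(dvdn_gt0 d0).
  case: e => [|[|[|e]]] // _; have := @totient_even e.+3 isT.
  by rewrite /=; set t := totient _; lia.
rewrite !big_split /= sum_divisors_totient // !sum_divisors_pred1 //.
by rewrite dvd1n dvdn2; lia.
Qed.

(** The inverse is supported on the numbers z p^k, where it takes the difference [w k] of F, with
    F(-1) read as 0. Over the divisors of z m these differences telescope to F at v_p(m). *)
Lemma moebius_transform_ppart (F : nat -> int) (f : nat -> int) (p z n : nat) :
  prime p -> (0 < z)%N -> (0 < n)%N ->
  (forall k m, ~~ (p %| m)%N -> f (z * (p ^ k * m))%N = F k) ->
  (forall d, ~~ (z %| d)%N -> f d = 0) ->
  [/\ n = z -> moebius_transform f n = F 0%N,
      forall k, n = (z * p ^ k.+1)%N -> moebius_transform f n = F k.+1 - F k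
    & (forall k, n <> (z * p ^ k)%N) -> moebius_transform f n = 0].
Proof.
move=> pp z0 n0 fF f0; have p1 := prime_gt1 pp.
pose w k := F k - (if k is k'.+1 then F k' else 0).
(* The sum must be finite. Since k < z p^k, every bound K >= e gives the same value at e, so K = d
   serves all divisors e of d at once. *)
pose g K e : int := \sum_(k < K) (e == (z * p ^ k)%N)%:R * w k.
have gK K e : (0 < e)%N -> (e <= K)%N -> g K e = g e e.
  move=> e0 eK.
  rewrite /g -!(big_mkord xpredT (fun k => (e == (z * p ^ k)%N)%:R * w k)).
  rewrite (big_cat_nat (n := e)) //=.
  rewrite [X in _ + X]big_nat [X in _ + X]big1 ?addr0 // => k.
  case/andP => ek _; case: eqP => [E|]; last by rewrite mul0r.
  by have := ltn_expl k p1; nia.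
have main : moebius_transform f n = g n n.
  apply: (@moebius_inversion _ (fun e => g e e)) => // d d0.
  transitivity (\sum_(e <- divisors d) g d e); last first.
    rewrite [LHS]big_seq [RHS]big_seq; apply: eq_bigr => e.
    rewrite -dvdn_divisors // => ed; apply: gK; last exact: dvdn_leq.
    exact: dvdn_gt0 ed.
  rewrite exchange_big /=.
  under eq_bigr => k _ do rewrite sum_divisors_pred1 //.
  have [/dvdnP[m dE]|zd] := boolP (z %| d)%N; last first.
    rewrite f0 // big1 // => k _; case: (boolP (_ %| _)%N); rewrite ?mul0r //.
    by move=> /(dvdn_trans (dvdn_mulr _ (dvdnn z))); rewrite (negPf zd).
  have m0 : (0 < m)%N by case: (m) dE d0 => // ->.
  have [u pu mE] := pfactor_coprime pp m0.
  have md : (m <= d)%N by rewrite dE leq_pmulr.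
  rewrite dE mulnC {1}mE [(u * _)%N]mulnC fF -?prime_coprime //.
  rewrite -(big_mkord xpredT (fun k => (z * p ^ k %| z * m)%N%:R * w k)).
  have lm : (logn p m < m)%N.
    by apply: leq_trans (ltn_expl _ p1) _; rewrite dvdn_leq ?pfactor_dvdnn.
  rewrite (big_cat_nat (n := (logn p m).+1)) //=; last by rewrite dE in md; lia.
  rewrite [X in _ + X]big_nat [X in _ + X]big1 ?addr0; last first.
    move=> k /andP[lk _].
    by rewrite dvdn_pmul2l // pfactor_dvdn // leqNgt lk mul0r.
  transitivity (\sum_(0 <= k < (logn p m).+1) w k).
    rewrite big_nat_recl // /w subr0.
    by rewrite (telescope_sumr _ (leq0n _)) addrC subrK.
  apply: eq_big_nat => k /andP[_ lk].
  by rewrite dvdn_pmul2l // pfactor_dvdn // -ltnS lk mul1r.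
have gw k : n = (z * p ^ k)%N -> moebius_transform f n = w k.
  move=> nE; rewrite main /g.
  have kn : (k < n)%N by have := ltn_expl k p1; nia.
  rewrite (bigD1 (Ordinal kn)) //= -nE eqxx mul1r big1 ?addr0 // => i ik.
  case: eqP => [E|]; last by rewrite mul0r.
  case/eqP: ik; apply/val_inj => /=; apply/eqP.
  by rewrite -(eqn_exp2l _ _ p1) -(eqn_pmul2l z0) -nE -E.
split=> [nz|k nE|nE]; first by rewrite (gw 0%N) /w ?subr0 // expn0 muln1.
  by rewrite (gw k.+1).
by rewrite main /g big1 // => k _; case: eqP => [/nE|]; rewrite // mul0r.
Qed.

(** * The p-adic valuation of products, powers and Moebius duals *)

Lemma vp_ratio (p : nat) (a b : int) : a != 0 -> b != 0 ->
  vp p (a%:Q / b%:Q) = (logn p `|a|)%:Z - (logn p `|b|)%:Z.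
Proof.
move=> a0 b0; set x := _ / _; have x0 : numq x != 0.
  by rewrite numq_eq0 mulf_neq0 ?invr_eq0 ?intr_eq0.
(* The fraction a/b need not be reduced; cross-multiplication compares it with its reduced form
   inside the integers. *)
have : numq x * b = a * denq x.
  apply: (@intr_inj rat); rewrite !rmorphM /=.
  apply: (@mulIf _ (denq x)%:~R^-1).
    by rewrite invr_eq0 intr_eq0 denq_neq0.
  rewrite mulrAC divq_num_den mulfK ?intr_eq0 ?denq_neq0 //.
  by rewrite /x divfK ?intr_eq0.
move/(congr1 (fun y => logn p `|y|%N)).
rewrite !abszM !lognM ?absz_gt0 ?denq_neq0 //.
by rewrite /vp; lia.
Qed.

Lemma vpM (p : nat) (x y : rat) : x != 0 -> y != 0 ->
  vp p (x * y) = vp p x + vp p y.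
Proof.
move=> x0 y0; rewrite -{1}[x]divq_num_den -{1}[y]divq_num_den mulf_div -!intrM.
rewrite vp_ratio ?mulf_neq0 ?numq_eq0 ?denq_neq0 //.
rewrite !abszM !lognM ?absz_gt0 ?numq_eq0 ?denq_neq0 //.
by rewrite /vp; lia.
Qed.

Lemma vpX (p : nat) (x : rat) (k : int) : x != 0 -> vp p (x ^ k) = k * vp p x.
Proof.
have vp1 : vp p 1 = 0 by rewrite (vp_int p 1) logn1.
have vpV y : y != 0 -> vp p y^-1 = - vp p y.
  move=> y0; have := @vpM p y y^-1 y0; rewrite invr_eq0 y0 divff // vp1.
  by move=> /(_ isT); lia.
have vpXn y m : y != 0 -> vp p (y ^+ m) = m%:Z * vp p y.
  move=> y0; elim: m => [|m IHm]; first by rewrite expr0 vp1 mul0r.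
  by rewrite exprS vpM ?expf_neq0 // IHm; lia.
move=> x0; case: k => m; first by rewrite -exprnP vpXn.
by rewrite NegzE -exprnN vpV ?expf_neq0 // vpXn //; lia.
Qed.

(** Nonvanishing of the A d makes [vp] additive on the product; the induction on the list of
    divisors only keeps that its entries are positive. *)
Lemma vp_moebius_dual (p : nat) (A : nat -> int) (n : nat) : (0 < n)%N ->
  (forall d, (0 < d)%N -> A d != 0) ->
  vp p (moebius_dual A n) = moebius_transform (fun d => (logn p `|A d|)%:Z) n.
Proof.
move=> n0 A0; rewrite /moebius_dual /moebius_transform.
have: all (fun d => 0 < d)%N (divisors n).
  by apply/allP => d; rewrite -dvdn_divisors //; apply: dvdn_gt0.
elim: (divisors n) => [|d s IHs] /=.
  by rewrite !big_nil (vp_int p 1) logn1.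
case/andP=> d0 s0; rewrite !big_cons vpM ?IHs ?vpX ?vp_int ?intr_eq0 ?A0 //.
  by rewrite expfz_neq0 ?intr_eq0 ?A0.
elim: s s0 {IHs} => [|e s IHs] /=; first by rewrite big_nil oner_eq0.
case/andP=> e0 /IHs ?.
by rewrite big_cons mulf_neq0 // expfz_neq0 ?intr_eq0 ?A0.
Qed.

(** * Second-order recurrences over the integers *)

Lemma nat_ind2 (T : nat -> Prop) : T 0%N -> T 1%N ->
  (forall n, T n -> T n.+1 -> T n.+2) -> forall n, T n.
Proof.
move=> T0 T1 TS n; suff: T n /\ T n.+1 by case.
by elim: n => [|n [? ?]]; split=> //; apply: TS.
Qed.

(** [lucas_rec] recurses by shifting its initial values, so the three-term relation needs an
    induction generalized over them. *)
Lemma lucas_recSS (P Q a b : int) (n : nat) :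
  lucas_rec P Q a b n.+2
  = P * lucas_rec P Q a b n.+1 - Q * lucas_rec P Q a b n.
Proof. by elim: n a b => [|n IHn] a b //=; rewrite -IHn. Qed.

Lemma lucas_rec_uniq (P Q : int) (W : nat -> int) :
  (forall n, W n.+2 = P * W n.+1 - Q * W n) ->
  forall n, W n = lucas_rec P Q (W 0%N) (W 1%N) n.
Proof.
move=> WSS; apply: nat_ind2 => // n IH0 IH1.
by rewrite WSS lucas_recSS IH0 IH1.
Qed.

Lemma lucas_recZ (P Q a b s : int) (n : nat) :
  lucas_rec (s * P) (s ^+ 2 * Q) a (s * b) n = s ^+ n * lucas_rec P Q a b n.
Proof.
pose W k := s ^+ k * lucas_rec P Q a b k.
have WSS k : W k.+2 = s * P * W k.+1 - s ^+ 2 * Q * W k.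
  by rewrite /W lucas_recSS !exprS; ring.
by rewrite -[RHS]/(W n) (lucas_rec_uniq WSS) /W expr0 expr1 mul1r.
Qed.

Lemma dvdz_congr (N x y : int) : (N %| x - y)%Z -> (N %| x)%Z = (N %| y)%Z.
Proof.
move=> Nxy; apply/idP/idP => [Nx|Ny]; first by rewrite -[y](subKr x) rpredB.
by rewrite -[x](subrK y) rpredD.
Qed.

Lemma dvdz_lucas_recB (N P Q P' Q' a b a' b' : int) :
  (N %| P - P')%Z -> (N %| Q - Q')%Z -> (N %| a - a')%Z -> (N %| b - b')%Z ->
  forall n, (N %| lucas_rec P Q a b n - lucas_rec P' Q' a' b' n)%Z.
Proof.
move=> NP NQ Na Nb; apply: nat_ind2 => // n IH0 IH1.
rewrite !lucas_recSS; set u := lucas_rec P Q a b n in IH0 *.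
set v := lucas_rec P' Q' a' b' n in IH0 *.
set u1 := lucas_rec P Q a b n.+1 in IH1 *.
set v1 := lucas_rec P' Q' a' b' n.+1 in IH1 *.
have -> : P * u1 - Q * u - (P' * v1 - Q' * v)
  = P * (u1 - v1) + (P - P') * v1 - Q * (u - v) - (Q - Q') * v by ring.
by do ![apply: rpredB | apply: rpredD]; [exact: dvdz_mull | exact: dvdz_mulr
  | exact: dvdz_mull | exact: dvdz_mulr].
Qed.

(** The recurrence form of [lucasU], free of complex numbers and meaningful for discriminant 0 as
    well, as for the parameters (2h, h^2) that appear in the congruences. *)
Definition lucas (P Q : int) : nat -> int := lucas_rec P Q 0 1.

Lemma lucasSS (P Q : int) (n : nat) :
  lucas P Q n.+2 = P * lucas P Q n.+1 - Q * lucas P Q n.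
Proof. exact: lucas_recSS. Qed.

Lemma lucasUE (P Q : int) (n : nat) : lucas_disc P Q != 0 ->
  lucasU P Q n = lucas P Q n.
Proof.
move=> D0; apply: (@intr_inj algC); rewrite lucasU_binet //.
have ab := lucas_alphaBbeta_neq0 D0.
pose c := (lucas_alpha P Q - lucas_beta P Q)^-1.
rewrite (@lucas_recP _ _ _ _ c (- c)) ?subrr //.
  by rewrite mulNr -mulrBr mulrC.
by rewrite mulNr -mulrBr mulVf.
Qed.

(** * Addition, norm and multisection identities *)

Section LucasSequence.

Variables P Q : int.
Local Notation U := (lucas P Q).

(** The factor U_{m+1} - P U_m stands for -Q U_{m-1}; this form needs no predecessor and holds at m
    = 0. *)
Lemma lucasD (m n : nat) : U (m + n) = U m * U n.+1 + (U m.+1 - P * U m) * U n.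
Proof.
move: n; apply: nat_ind2 => [||n IH0 IH1].
- by rewrite addn0 /lucas /=; ring.
- by rewrite addn1 (lucasSS _ _ 0) /lucas /=; ring.
rewrite !addnS lucasSS -addnS IH0 IH1 (lucasSS _ _ n.+1) (lucasSS _ _ n).
by ring.
Qed.

(** This is the norm of alpha^n = U_{n+1} - beta U_n. *)
Lemma lucas_cassini (n : nat) :
  Q ^+ n = U n.+1 ^+ 2 - P * U n * U n.+1 + Q * U n ^+ 2.
Proof.
elim: n => [|n IHn]; first by rewrite expr0 /lucas /=; ring.
by rewrite exprS IHn lucasSS; ring.
Qed.

(** The new parameters are the sum V_m and the product of alpha^m and beta^m, so the Binet quotient
    for m k factors through alpha^m - beta^m. *)
Lemma lucas_multisection (m k : nat) :
  U (m * k) = U m * lucas (2 * U m.+1 - P * U m) (Q ^+ m) k.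
Proof.
move: k; apply: nat_ind2 => [||k IH0 IH1].
- by rewrite muln0 /lucas /= mulr0.
- by rewrite muln1 /lucas /= mulr1.
rewrite [in RHS]lucasSS mulrBr ![U m * (_ * _)]mulrCA -IH0 -IH1.
(* With Q^m expanded by the norm identity and indices split by the addition law, a polynomial
   identity in the terms at m, m+1, j, j+1 remains. *)
rewrite lucas_cassini; set j := (m * k)%N.
have -> : (m * k.+1 = j + m)%N by rewrite /j; lia.
have -> : (m * k.+2 = (j + m) + m)%N by rewrite /j; lia.
rewrite !lucasD -addSn lucasD lucasSS; ring.
Qed.

Lemma dvdz_lucas (m n : nat) : (m %| n)%N -> (U m %| U n)%Z.
Proof.
by case/dvdnP=> k ->; rewrite mulnC lucas_multisection dvdz_mulr.
Qed.

Section Prime.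

Variable p : nat.
Hypothesis pp : prime p.

Lemma Euclid_dvdzM (x y : int) : (p %| x * y)%Z = (p %| x)%Z || (p %| y)%Z.
Proof. by rewrite !dvdzE abszM Euclid_dvdM. Qed.

Lemma Euclid_dvdzX (x : int) (n : nat) :
  (p %| x ^+ n)%Z = (p %| x)%Z && (0 < n)%N.
Proof. by rewrite !dvdzE abszX Euclid_dvdX. Qed.

Lemma logz_eq0 (x : int) : ~~ (p %| x)%Z -> logn p `|x| = 0%N.
Proof. by rewrite dvdzE => px; rewrite logn_coprime // prime_coprime. Qed.

Lemma lognzM (x y : int) : x != 0 -> y != 0 ->
  logn p `|x * y| = (logn p `|x| + logn p `|y|)%N.
Proof. by move=> x0 y0; rewrite abszM lognM ?absz_gt0. Qed.

Lemma logz_eq1 (x u : int) : (p%:Z ^+ 2 %| x - p%:Z * u)%Z -> ~~ (p %| u)%Z ->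
  logn p `|x| = 1%N.
Proof.
have p0 : p%:Z != 0 by have := prime_gt0 pp; lia.
case/dvdzP=> t xE pu; have -> : x = p%:Z * (u + t * p%:Z).
  by rewrite -[LHS](subrK (p%:Z * u)) xE; ring.
have pt : ~~ (p %| u + t * p%:Z)%Z by rewrite rpredDr ?dvdz_mull.
rewrite lognzM //; last by apply: contraNneq pt => ->; rewrite dvdz0.
by rewrite (logz_eq0 pt) addn0 /= logn_prime // eqxx.
Qed.

End Prime.
End LucasSequence.

(** * Congruences to a sequence with a double root *)

Lemma lucas_square (h : int) (n : nat) :
  lucas (2 * h) (h ^+ 2) n.+1 = n.+1%:R * h ^+ n.
Proof.
move: n; apply: nat_ind2 => [||n IH0 IH1].
- by rewrite expr0.
- by rewrite /lucas /= expr1; ring.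
by rewrite lucasSS IH0 IH1 !exprS -!natr1; ring.
Qed.

Lemma dvdz_lucasB (N P Q P' Q' : int) (n : nat) :
  (N %| P - P')%Z -> (N %| Q - Q')%Z -> (N %| lucas P Q n - lucas P' Q' n)%Z.
Proof. by move=> NP NQ; apply: dvdz_lucas_recB; rewrite ?subrr ?dvdz0. Qed.

Lemma lucas_square_congr (N P Q h : int) (n : nat) :
  (N %| P - 2 * h)%Z -> (N %| Q - h ^+ 2)%Z ->
  (N %| lucas P Q n.+1 - n.+1%:R * h ^+ n)%Z.
Proof. by move=> NP NQ; rewrite -lucas_square; apply: dvdz_lucasB. Qed.

(** The double root is h = U_{m+1} - c U_m, which would be V_m/2 for c = P/2. The errors are V_m -
    2h = (2c - P) U_m and Q^m - h^2 = (2c - P) U_m U_{m+1} + (Q - c^2) U_m^2. *)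
Lemma lucas_multisection_congr (N P Q c : int) (m k : nat) :
  (N %| lucas P Q m ^+ 2)%Z -> (N %| (2 * c - P) * lucas P Q m)%Z ->
  (N %| lucas (2 * lucas P Q m.+1 - P * lucas P Q m) (Q ^+ m) k.+1
        - k.+1%:R * (lucas P Q m.+1 - c * lucas P Q m) ^+ k)%Z.
Proof.
move=> NU2 NcU; apply: lucas_square_congr.
  set u := lucas P Q m in NcU *; set v := lucas P Q m.+1.
  by rewrite (_ : _ - _ = (2 * c - P) * u) //; ring.
rewrite (lucas_cassini P).
set u := lucas P Q m in NU2 NcU *; set v := lucas P Q m.+1.
rewrite (_ : _ - _ = (2 * c - P) * u * v + (Q - c ^+ 2) * u ^+ 2); last by ring.
by apply: rpredD; [exact: dvdz_mulr | exact: dvdz_mull].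
Qed.

(** * Divisibility and valuations of U at a prime not dividing Q *)

Section PrimeToQ.

Variables (P Q : int) (p : nat).
Hypothesis pp : prime p.
Hypothesis pQ : ~~ (p %| Q)%Z.
Local Notation U := (lucas P Q).
Hypothesis U_neq0 : forall n, (0 < n)%N -> U n != 0.

(** By the norm identity, a common prime factor of U_m and U_{m+1} divides Q^m. *)
Lemma Ndvdz_lucas_succ (m : nat) : (p %| U m)%Z -> ~~ (p %| U m.+1)%Z.
Proof.
move=> pU; apply: contra pQ => pU1.
have : (p %| Q ^+ m)%Z.
  rewrite (lucas_cassini P); apply: rpredD; last exact/dvdz_mull/dvdz_exp.
  by apply: rpredB; [exact: dvdz_exp | exact: dvdz_mull].
by rewrite Euclid_dvdzX // => /andP[].
Qed.

(** Writing n = q z + r, the addition law reduces U_n modulo p to U_r U_{qz+1}, whose second factor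
    is a unit. *)
Lemma dvdz_lucas_rank (z : nat) : (0 < z)%N -> (p %| U z)%Z ->
  (forall r, (0 < r)%N -> (r < z)%N -> ~~ (p %| U r)%Z) ->
  forall n, (p %| U n)%Z = (z %| n)%N.
Proof.
move=> z0 pz zmin n; apply/idP/idP => [|zn]; last first.
  exact: dvdz_trans (dvdz_lucas _ _ zn).
have pqz : (p %| U (n %/ z * z))%Z.
  by apply: dvdz_trans pz (dvdz_lucas _ _ _); apply: dvdn_mull.
rewrite [in U n](divn_eq n z) addnC lucasD rpredDr; last by rewrite dvdz_mull.
rewrite Euclid_dvdzM // (negPf (Ndvdz_lucas_succ pqz)) orbF /dvdn => pr.
by apply: contraLR pr; rewrite -lt0n => r0; apply: zmin; rewrite ?ltn_mod.
Qed.

(** The cofactor of U_m in U_{mk} is k U_{m+1}^(k-1) modulo p, a unit. *)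
Lemma logn_lucas_coprime (m k : nat) : (0 < m)%N -> (p %| U m)%Z ->
  ~~ (p %| k)%N -> logn p `|U (m * k)| = logn p `|U m|.
Proof.
move=> m0 pU pk; case: k => [|k] in pk *; first by rewrite dvdn0 in pk.
have := U_neq0 (ltn0Sn (m * k.+1).-1); rewrite prednK ?muln_gt0 ?m0 //.
rewrite lucas_multisection mulf_eq0 negb_or => /andP[_ L0].
rewrite lognzM ?U_neq0 // [X in (_ + X)%N](logz_eq0 pp) ?addn0 //.
have := @lucas_multisection_congr p P Q 0 m k.
rewrite dvdz_exp // dvdz_mull // mul0r subr0 => /(_ isT isT) pL.
rewrite (dvdz_congr pL).
rewrite Euclid_dvdzM // Euclid_dvdzX // (negPf (Ndvdz_lucas_succ pU)) orbF.
by rewrite natz.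
Qed.

(** Modulo p^2 the cofactor of U_m in U_{mp} is p h^(p-1) with h prime to p, which adds exactly one
    factor p. *)
Lemma logn_lucas_mulp (m : nat) (c : int) : (0 < m)%N -> (p %| U m)%Z ->
  (p%:Z ^+ 2 %| (2 * c - P) * U m)%Z ->
  logn p `|U (m * p)| = (logn p `|U m|).+1.
Proof.
move=> m0 pU pcU; have p0 := prime_gt0 pp.
have := U_neq0 (ltn0Sn (m * p).-1); rewrite prednK ?muln_gt0 ?m0 //.
rewrite lucas_multisection mulf_eq0 negb_or => /andP[_ L0].
rewrite lognzM ?U_neq0 // -[RHS]addn1; congr (_ + _)%N.
have := @lucas_multisection_congr (p%:Z ^+ 2) P Q c m p.-1.
rewrite dvdz_exp2r // prednK // => /(_ isT pcU) pL.
apply: (logz_eq1 pp (u := (U m.+1 - c * U m) ^+ p.-1)).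
  by move: pL; rewrite (natz p).
rewrite Euclid_dvdzX // negb_and rpredBr ?dvdz_mull //.
by rewrite (negPf (Ndvdz_lucas_succ pU)).
Qed.

Lemma logn_lucas_rank (z k m : nat) : (0 < z)%N -> (p %| U z)%Z ->
  ~~ (p %| m)%N -> logn p `|U (z * (p ^ k * m))| = logn p `|U (z * p ^ k)|.
Proof.
move=> z0 pz pm.
rewrite mulnA logn_lucas_coprime ?muln_gt0 ?z0 ?expn_gt0 ?prime_gt0 //.
by apply: dvdz_trans pz (dvdz_lucas _ _ _); apply: dvdn_mulr.
Qed.

Lemma logn_lucas_rankS (z k : nat) : (0 < z)%N -> (p %| U z)%Z ->
  logn p `|U (z * p ^ k.+2)| = (logn p `|U (z * p ^ k.+1)|).+1.
Proof.
move=> z0 pz; rewrite expnSr mulnA.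
have pU : (p %| U (z * p ^ k.+1))%Z.
  by apply: dvdz_trans pz (dvdz_lucas _ _ _); apply: dvdn_mulr.
apply: (@logn_lucas_mulp _ 0); rewrite ?muln_gt0 ?z0 ?expn_gt0 ?prime_gt0 //.
rewrite dvdz_mull //; apply: (@dvdz_trans (U (z * p))); last first.
  by apply: dvdz_lucas; rewrite expnS mulnA dvdn_mulr.
have := @lucas_multisection_congr p P Q 0 z p.-1.
rewrite prednK ?prime_gt0 // dvdz_exp // dvdz_mull // => /(_ isT isT) pL.
rewrite lucas_multisection expr2 dvdz_mul //.
by rewrite (dvdz_congr pL) dvdz_mulr // natz.
Qed.

Hypothesis pD : (p %| P ^+ 2 - 4 * Q)%Z.

Lemma half_mod_disc : exists c, (p %| 2 * c - P)%Z.
Proof.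
have [p2|p_odd] := even_prime pp.
  exists 0; rewrite mulr0 sub0r rpredN; move: pD.
  rewrite (@dvdz_congr _ _ (P ^+ 2)) ?Euclid_dvdzX // => [/andP[]//|].
  by rewrite addrAC subrr add0r rpredN p2 dvdz_mulr.
(* (p + 1)/2 is the inverse of 2 modulo the odd prime p. *)
exists (P * (p./2.+1)%:Z); have -> : 2 * (P * (p./2.+1)%:Z) - P = P * p%:Z.
  have -> : p%:Z = 2 * p./2%:Z + 1 by lia.
  have -> : p./2.+1%:Z = p./2%:Z + 1 by lia.
  by ring.
exact: dvdz_mull.
Qed.

(** For p = 2, P is even and Q odd, so the root is 1. For odd p the root is P/2 modulo p, and p
    divides 4 (Q - c^2). *)
Lemma double_root_mod_disc :
  exists h, (p %| P - 2 * h)%Z && (p %| Q - h ^+ 2)%Z.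
Proof.
have [c pc] := half_mod_disc.
have [p2|p_odd] := even_prime pp.
  exists 1; move: pc pQ; rewrite p2 expr1n; clear=> pc pQ.
  by apply/andP; split; lia.
exists c; rewrite -opprB rpredN pc /=.
have: (p %| 2 * (2 * (Q - c ^+ 2)))%Z.
  have -> : 2 * (2 * (Q - c ^+ 2))
    = - (P ^+ 2 - 4 * Q) - (2 * c - P) * (2 * c + P) by ring.
  by rewrite rpredB ?rpredN // dvdz_mulr.
rewrite !Euclid_dvdzM // (_ : (p %| 2)%Z = false) //.
rewrite dvdzE /= dvdn_prime2 //; apply: contraTF p_odd => /eqP ->.
by [].
Qed.

(** Modulo p, U_{m+1} is (m+1) h^m for a unit h, so the rank of p is p itself. *)
Lemma dvdz_lucas_disc (m : nat) : (p %| U m)%Z = (p %| m)%N.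
Proof.
case: m => [|m]; first by rewrite dvdn0 dvdz0.
have [h /andP[ph1 ph2]] := double_root_mod_disc.
have /negPf ph : ~~ (p %| h)%Z.
  by apply: contra pQ => ph; rewrite (dvdz_congr ph2) dvdz_exp.
have pL := lucas_square_congr m ph1 ph2.
rewrite (dvdz_congr pL).
by rewrite Euclid_dvdzM // Euclid_dvdzX // ph orbF natz.
Qed.

Lemma logn_lucas_disc (k m : nat) : ~~ (p %| m)%N ->
  logn p `|U (p ^ k * m)| = logn p `|U (p ^ k)|.
Proof.
case: k => [|k] pm.
  by rewrite mul1n !logz_eq0 // dvdz_lucas_disc ?Euclid_dvd1.
rewrite expnS -mulnA.
by rewrite logn_lucas_rank ?prime_gt0 // dvdz_lucas_disc.
Qed.

(** One factor p of the condition modulo p^2 comes from 2c - P, the other from U, so p | U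
    suffices. *)
Lemma logn_lucas_discS (k : nat) :
  logn p `|U (p ^ k.+2)| = (logn p `|U (p ^ k.+1)|).+1.
Proof.
have [c pc] := half_mod_disc; rewrite expnSr.
have pU : (p %| U (p ^ k.+1))%Z.
  by rewrite dvdz_lucas_disc dvdn_exp.
by apply: (logn_lucas_mulp (c := c)); rewrite ?expn_gt0 ?prime_gt0 // dvdz_mul.
Qed.

End PrimeToQ.

(** * Extracting powers of p: scaling, bisections, and the case v_p(Q) < 2 v_p(P) *)

Lemma lucas_scale (P Q s : int) (n : nat) :
  lucas (s * P) (s ^+ 2 * Q) n.+1 = s ^+ n * lucas P Q n.+1.
Proof.
move: n; apply: nat_ind2 => [||n IH0 IH1].
- by rewrite expr0 mul1r.
- by rewrite /lucas /=; ring.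
by rewrite lucasSS IH0 IH1 (lucasSS P _ n.+1) !exprS; ring.
Qed.

Lemma lucas_dvdQ (P Q : int) (N : int) (n : nat) : (N %| Q)%Z ->
  (N %| lucas P Q n.+1 - P ^+ n)%Z.
Proof.
move=> NQ; have -> : P ^+ n = lucas P 0 n.+1.
  elim: n => [|n IHn]; first by rewrite expr0.
  by rewrite exprS IHn lucasSS mul0r subr0.
by apply: dvdz_lucasB; rewrite ?subrr ?dvdz0 // subr0.
Qed.

(** Multisection at m = 2 has parameters P^2 - 2Q = s (x - 2q) and Q^2 = s^2 q^2; scaling then takes
    out s^k. *)
Lemma lucas_even (q x : int) (P Q s : int) (k : nat) :
  P ^+ 2 = s * x -> Q = s * q ->
  lucas P Q (2 * k.+1) = P * s ^+ k * lucas (x - 2 * q) (q ^+ 2) k.+1.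
Proof.
move=> P2E QE; rewrite lucas_multisection -mulrA -lucas_scale.
congr (_ * lucas _ _ _); rewrite /lucas /=; first by ring.
  by transitivity (P ^+ 2 - 2 * Q); [ring | rewrite P2E QE; ring].
by rewrite QE; ring.
Qed.

(** Odd-indexed terms obey the same recurrence as even-indexed ones, but start from U_1 = 1 and U_3
    = P^2 - Q = s (x - q). *)
Lemma lucas_odd (q x : int) (P Q s : int) (k : nat) :
  P ^+ 2 = s * x -> Q = s * q ->
  lucas P Q (2 * k).+1
  = s ^+ k * lucas_rec (x - 2 * q) (q ^+ 2) 1 (x - q) k.
Proof.
move=> P2E QE; rewrite -lucas_recZ.
have WSS n : lucas P Q (2 * n.+2).+1
    = s * (x - 2 * q) * lucas P Q (2 * n.+1).+1
      - s ^+ 2 * q ^+ 2 * lucas P Q (2 * n).+1.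
  have -> : (2 * n.+2 = (2 * n).+4)%N by lia.
  have -> : (2 * n.+1 = (2 * n).+2)%N by lia.
  have -> : s * (x - 2 * q) = P ^+ 2 - 2 * Q by rewrite P2E QE; ring.
  have -> : s ^+ 2 * q ^+ 2 = Q ^+ 2 by rewrite QE; ring.
  by rewrite !lucasSS; ring.
rewrite (lucas_rec_uniq (W := fun n => lucas P Q (2 * n).+1) WSS).
congr lucas_rec; transitivity (P ^+ 2 - Q); last by rewrite P2E QE; ring.
by rewrite /lucas /=; ring.
Qed.

(* For n + 2 = p >= 5 prime, the coefficient of x is divisible by p: this is why
   only p = 2 and p = 3 can be exceptional. *)
Lemma lucas_mod_sqr (h x : int) (n : nat) :
  (x ^+ 2 %| lucas (x + 2 * h) (h ^+ 2) n.+2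
             - (n.+2%:R * h ^+ n.+1 + 'C(n.+3, 3)%:R * x * h ^+ n))%Z.
Proof.
move: n; apply: nat_ind2 => [||n].
- by rewrite /lucas /= binn (_ : _ - _ = 0) ?dvdz0 //; ring.
- rewrite /lucas /= binSn (_ : _ - _ = x ^+ 2) ?dvdzz //; ring.
rewrite (lucasSS _ _ n.+2).
(* The second difference of m -> C(m, 3) is linear; this is the recurrence of the coefficients of
   x. *)
have -> : 'C(n.+4.+1, 3)%:R
    = 2 * 'C(n.+4, 3)%:R - 'C(n.+3, 3)%:R + n.+3%:R :> int.
  rewrite (binS n.+4) (binS n.+3 2) (binS n.+3 1) bin1.
  by rewrite !natrD; ring.
set L1 := lucas _ _ n.+3; set L0 := lucas _ _ n.+2.
set c1 := 'C(n.+4, 3)%:R; set c0 := 'C(n.+3, 3)%:R => H0 H1.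
rewrite (_ : _ - _
  = (x + 2 * h) * (L1 - (n.+3%:R * h ^+ n.+2 + c1 * x * h ^+ n.+1))
    - h ^+ 2 * (L0 - (n.+2%:R * h ^+ n.+1 + c0 * x * h ^+ n))
    + c1 * h ^+ n.+1 * x ^+ 2); last by rewrite !exprS -!natr1; ring.
by apply: rpredD; [apply: rpredB|]; exact: dvdz_mull.
Qed.

(* Here v_p(P) = a and v_p(Q) = b with b < 2a, and L k is U_{2k} divided by its
   factor P p^(b (k - 1)). *)
Section LargeP.

Variables (p a b : nat) (r q : int).
Hypothesis pp : prime p.
Hypothesis pr : ~~ (p %| r)%Z.
Hypothesis pq : ~~ (p %| q)%Z.
Hypothesis b_lt_2a : (b < 2 * a)%N.
Let P : int := r * p%:Z ^+ a.
Let Q : int := q * p%:Z ^+ b.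
Hypothesis U_neq0 : forall n, (0 < n)%N -> lucas P Q n != 0.
Let x : int := r ^+ 2 * p%:Z ^+ (2 * a - b).
Let L : nat -> int := lucas (x - 2 * q) (q ^+ 2).

Let p_neq0 : p%:Z != 0.
Proof. by have := prime_gt0 pp; lia. Qed.

Let r_neq0 : r != 0.
Proof. by apply: contraNneq pr => ->; rewrite dvdz0. Qed.

Let P2E : P ^+ 2 = p%:Z ^+ b * x.
Proof.
rewrite /P /x exprMn -exprM mulrCA -exprD subnKC; last exact: ltnW.
by rewrite mulnC.
Qed.

Let QE : Q = p%:Z ^+ b * q.
Proof. by rewrite /Q mulrC. Qed.

Let px : (p %| x)%Z.
Proof. by rewrite dvdz_mull // dvdz_exp // subn_gt0. Qed.

Let logn_exp (k : nat) : logn p `|p%:Z ^+ k| = k.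
Proof. by rewrite abszX /= pfactorK. Qed.

Let lognP : logn p `|P| = a.
Proof. by rewrite lognzM ?expf_neq0 // logz_eq0 // logn_exp. Qed.

Let L_neq0 (k : nat) : (0 < k)%N -> L k != 0.
Proof.
case: k => // k _; have := @U_neq0 (2 * k.+1) isT.
by rewrite (lucas_even _ P2E QE) mulf_eq0 negb_or => /andP[].
Qed.

Let logn_U_even (k : nat) :
  logn p `|lucas P Q (2 * k.+1)| = (a + k * b + logn p `|L k.+1|)%N.
Proof.
have P0 : P != 0 by rewrite mulf_neq0 ?expf_neq0.
rewrite (lucas_even _ P2E QE) lognzM ?mulf_neq0 ?expf_neq0 ?L_neq0 //.
rewrite lognzM ?expf_neq0 //.
by rewrite -exprM logn_exp lognP mulnC.
Qed.

(** Since p | x, the cofactor of p^(bk) is congruent to the sequence with x = 0, which is (-q)^k, a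
    unit. *)
Let logn_U_odd (k : nat) : logn p `|lucas P Q (2 * k).+1| = (k * b)%N.
Proof.
have := @U_neq0 (2 * k).+1 isT; rewrite (lucas_odd _ P2E QE).
rewrite mulf_eq0 negb_or => /andP[s0 Y0].
rewrite lognzM // -exprM logn_exp mulnC -[RHS]addn0; congr (_ + _)%N.
apply: logz_eq0 => //.
have pY := @dvdz_lucas_recB p (x - 2 * q) (q ^+ 2) (- 2 * q) (q ^+ 2)
  1 (x - q) 1 (- q).
have {}pY : (p %| lucas_rec (x - 2 * q) (q ^+ 2) 1 (x - q) k - (- q) ^+ k)%Z.
  have -> : (- q) ^+ k = lucas_rec (- 2 * q) (q ^+ 2) 1 (- q) k.
    have WSS n : (- q) ^+ n.+2 = - 2 * q * (- q) ^+ n.+1 - q ^+ 2 * (- q) ^+ n.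
      by rewrite !exprS; ring.
    by rewrite (lucas_rec_uniq (W := fun n => (- q) ^+ n) WSS) expr0 expr1.
  by apply: pY; rewrite ?subrr ?dvdz0 // (_ : _ - _ = x) //; ring.
by rewrite (dvdz_congr pY) Euclid_dvdzX // rpredN (negPf pq).
Qed.

Let pq2 : ~~ (p %| q ^+ 2)%Z.
Proof. by rewrite Euclid_dvdzX // andbT. Qed.

Let pdisc : (p %| (x - 2 * q) ^+ 2 - 4 * q ^+ 2)%Z.
Proof.
have -> : (x - 2 * q) ^+ 2 - 4 * q ^+ 2 = (x - 4 * q) * x by ring.
exact: dvdz_mull.
Qed.

Lemma moebius_transform_largeP (n : nat) : (0 < n)%N ->
  let M := moebius_transform (fun d => (logn p `|lucas P Q d|)%:Z) n in
  let c := (totient n %/ 2)%N%:Z * b%:Z in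
  [/\ n = 2%N -> M = c + a,
      n = (2 * p)%N -> M = c + logn p `|L p|,
      forall k, n = (2 * p ^ k.+2)%N -> M = c + 1
    & (forall k, n <> (2 * p ^ k)%N) -> M = c].
Proof.
move=> n0 M c.
(* The valuation of U_d is b floor((d-1)/2) + f d. The first part transforms to c; f lives on even d
   and depends on the p-part of d/2, so z = 2 applies. *)
pose f d : int := if (2 %| d)%N then a + logn p `|L (d %/ 2)| else 0.
have -> : M = c + moebius_transform f n.
  rewrite /c mulrC -(moebius_transform_half n0).
  rewrite -moebius_transformZ -moebius_transformD.
  apply: eq_moebius_transform => // d d0.
  have [/dvdnP[k dE]|d2] := boolP (2 %| d)%N.
    case: k dE => [dE|k dE]; first by rewrite dE in d0.
    rewrite /f dE dvdn_mull // mulnK // mulnC logn_U_even.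
    rewrite (_ : (2 * k.+1).-1 %/ 2 = k)%N; last by clear; lia.
    by rewrite !PoszD PoszM; ring.
  have -> : d = (2 * (d %/ 2)).+1 by clear -d2; lia.
  rewrite logn_U_odd /f (_ : (2 %| _)%N = false); last by clear; lia.
  rewrite (_ : (_.+1.-1 %/ 2 = d %/ 2)%N) ?PoszM ?addr0 1?mulrC //.
  by clear; lia.
have Lk := logn_lucas_disc pp pq2 L_neq0 pdisc.
have LS k : logn p `|L (p ^ k.+2)| = (logn p `|L (p ^ k.+1)|).+1.
  exact: logn_lucas_discS.
have fF k m : ~~ (p %| m)%N ->
    f (2 * (p ^ k * m))%N = a%:Z + logn p `|L (p ^ k)|.
  by move=> pm; rewrite /f dvdn_mulr // mulKn // Lk.
have f0 d : ~~ (2 %| d)%N -> f d = 0 by move=> /negPf d2; rewrite /f d2.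
have [F0 FS Fn] := moebius_transform_ppart pp (isT : 0 < 2)%N n0 fF f0.
have L1 : logn p `|L 1| = 0%N by rewrite logn1.
split=> [n2|n2p|k nE|nE].
- by rewrite F0 // expn0 L1 addr0.
- by rewrite (FS 0%N) ?expn1 // expn0 L1; congr (_ + _); clear; lia.
- rewrite (FS _ nE) LS; congr (_ + _); clear; lia.
- by rewrite Fn // addr0.
Qed.

(** Modulo p^2, L_p is p (-q)^(p-1) plus C(p+1, 3) x (-q)^(p-2). The last term vanishes if p^2 | x;
    otherwise 2a = b + 1, hence p >= 5 and p divides the binomial. *)
Lemma logn_lucas_p_generic : ~ (2 * a = b + 1 /\ (p = 2 \/ p = 3))%N ->
  logn p `|L p| = 1%N.
Proof.
move=> nexc; have [k pE] : exists k, p = k.+2.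
  by exists p.-2; case: (p) (prime_gt1 pp) => [|[]].
apply: (logz_eq1 pp (u := (- q) ^+ k.+1)); last first.
  by rewrite Euclid_dvdzX // rpredN (negPf pq).
have := lucas_mod_sqr (- q) x k; rewrite -pE mulrN sqrrN -/L => xL.
have := dvdz_trans (dvdz_exp2r 2 px) xL.
rewrite opprD addrA (natz p) -mulrA => {}xL.
set y := _ * (x * _) in xL; suff py : (p%:Z ^+ 2 %| y)%Z.
  by rewrite -[X in (_ %| X)%Z](subrK y) rpredD.
have [p2x|px2] := boolP (p%:Z ^+ 2 %| x)%Z.
  by rewrite /y dvdz_mull // dvdz_mulr.
rewrite /y expr2 dvdz_mul //; last by rewrite dvdz_mulr.
have {px2}ab : (2 * a = b + 1)%N.
  apply/eqP; apply: contraR px2 => ab; apply: dvdz_mull.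
  by apply: dvdz_exp2l; move: ab b_lt_2a; clear; lia.
rewrite natz dvdzE /=.
have p5 : (4 < p)%N.
  by case: (p) pp nexc => [|[|[|[|[|]]]]] // _ []; split=> //; [left | right].
(* Divisibility is tested on 3! C(p+1, 3) = (p+1) p (p-1). *)
have cop : coprime p 3`!.
  rewrite (coprimeMr _ 3 2) !prime_coprime // gtnNdvd // ?gtnNdvd //.
    exact: ltn_trans p5.
  exact: ltn_trans p5.
rewrite -(Gauss_dvdl _ cop) bin_ffact !ffactnS ffactn0.
by rewrite [(p.+1 * _)%N]mulnC /= dvdn_mulr // dvdn_mulr.
Qed.

(** Here x = p r^2, so L_2 = 2 (r^2 - q) for p = 2, and L_3 = (x - q) 3 (r^2 - q) with x - q a unit
    for p = 3. *)
Lemma logn_lucas_p_exceptional : (2 * a = b + 1)%N -> p = 2%N \/ p = 3%N ->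
  logn p `|L p| = (1 + logn p `|r ^+ 2 - q|)%N.
Proof.
move=> ab; have xE : x = r ^+ 2 * p%:Z by rewrite /x ab addKn expr1.
have := L_neq0 (prime_gt0 pp); rewrite /L => + p23.
have logp : logn p `|p%:Z| = 1%N by rewrite /= logn_prime // eqxx.
case: p23 => p23.
  have -> : lucas (x - 2 * q) (q ^+ 2) p = p%:Z * (r ^+ 2 - q).
    by rewrite xE p23 /lucas /=; ring.
  rewrite mulf_eq0 negb_or => /andP[_ e0].
  by rewrite lognzM // logp.
have -> : lucas (x - 2 * q) (q ^+ 2) p = (x - q) * (p%:Z * (r ^+ 2 - q)).
  by rewrite xE p23 /lucas /=; ring.
rewrite !mulf_eq0 !negb_or => /and3P[xq0 _ e0].
rewrite !lognzM ?mulf_neq0 // logp logz_eq0 //.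
by rewrite (@dvdz_congr _ _ (- q)) ?rpredN // opprK subrK.
Qed.

End LargeP.

(** * The p-free part and the entry point *)

Lemma PoszX (m n : nat) : (m ^ n)%N%:Z = m%:Z ^+ n.
Proof. by rewrite -[LHS]natz natrX natz. Qed.

Lemma Ndvdz_pfree (p : nat) (m : int) : prime p -> m != 0 ->
  ~~ (p %| pfree p m)%Z.
Proof.
move=> pp m0; apply/negP => /dvdzP[t tE].
have := pfreeK p m.
move: tE; rewrite /pfree; set k := logn p `|m|; set u := (_ %/ _)%Z => -> mE.
have : ~~ (p ^ k.+1 %| `|m|)%N by rewrite pfactor_dvdn ?absz_gt0 // ltnn.
move/negP; apply.
by rewrite -mE -mulrA abszM dvdn_mull // abszM /= expnS.
Qed.

Variant entry_point_spec (A : nat -> int) (p : nat) : nat -> Prop :=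
| EntryPoint (z : nat) of (0 < z)%N & (p %| A z)%Z
    & (forall r, (0 < r)%N -> (r < z)%N -> ~~ (p %| A r)%Z) :
    entry_point_spec A p z
| NoEntryPoint of (forall n, (0 < n)%N -> ~~ (p %| A n)%Z) :
    entry_point_spec A p 0.

Lemma entry_pointP (A : nat -> int) (p : nat) :
  entry_point_spec A p (entry_point A p).
Proof.
rewrite /entry_point; case: pselect => [ex|nex]; last first.
  apply: NoEntryPoint => n n0; apply: contra_notN nex => pA.
  by exists n; rewrite n0.
case: ex_minnP => z /andP[z0 pz] zmin; apply: EntryPoint => // r r0 rz.
by apply/negP => pr; have := zmin r; rewrite r0 pr leqNgt rz => /(_ isT).
Qed.

Lemma moebius_transform_0 (f : nat -> int) (n : nat) : (0 < n)%N ->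
  (forall d, (0 < d)%N -> f d = 0) -> moebius_transform f n = 0.
Proof.
move=> n0 f0; rewrite (@eq_moebius_transform _ (fun=> 0 * 1)) //.
by rewrite moebius_transformZ mul0r.
Qed.

(** * The transform of d -> v_p(U_d) for p not dividing gcd(P, Q), and under scaling *)

Section Coprime.

Variables (P Q : int) (p n : nat).
Hypotheses (pp : prime p) (n0 : (0 < n)%N).
Hypothesis U_neq0 : forall d, (0 < d)%N -> lucas P Q d != 0.
Local Notation M := (moebius_transform (fun d => (logn p `|lucas P Q d|)%:Z) n).

Lemma moebius_transform_dvdQ : (p %| Q)%Z -> ~~ (p %| P)%Z -> M = 0.
Proof.
move=> pQ pP; apply: moebius_transform_0 => // -[//|d] _.
rewrite logz_eq0 // (dvdz_congr (lucas_dvdQ P d pQ)) Euclid_dvdzX //.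
by rewrite (negPf pP).
Qed.

Lemma moebius_transform_disc : ~~ (p %| Q)%Z -> (p %| P ^+ 2 - 4 * Q)%Z ->
  [/\ n = p -> M = logn p `|lucas P Q p|,
      forall k, n = (p ^ k.+2)%N -> M = 1
    & (forall k, n <> (p ^ k.+1)%N) -> M = 0].
Proof.
move=> pQ pD.
(* Taking z = 1 rather than the rank p makes F 0 = v_p(U_1) = 0, so the value at n = p is
   v_p(U_p). *)
have fF k m : ~~ (p %| m)%N ->
    (logn p `|lucas P Q (1 * (p ^ k * m))|)%:Z = logn p `|lucas P Q (p ^ k)|.
  by move=> pm; rewrite mul1n logn_lucas_disc.
have f0 d : ~~ (1 %| d)%N -> (logn p `|lucas P Q d|)%:Z = 0 by rewrite dvd1n.
have [F0 FS Fn] := moebius_transform_ppart pp (isT : 0 < 1)%N n0 fF f0.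
have F00 : logn p `|lucas P Q (p ^ 0)| = 0%N by rewrite /lucas /= logn1.
split=> [np|k nE|nE].
- by rewrite (FS 0%N) ?expn1 ?mul1n // F00 subr0.
- by rewrite (FS k.+1) ?mul1n // logn_lucas_discS // intS addrK.
have [n1|n1] := eqVneq n 1%N; first by rewrite F0 // F00.
by apply: Fn => -[|k]; rewrite mul1n //; apply/eqP.
Qed.

Lemma moebius_transform_rank (z : nat) : ~~ (p %| Q)%Z ->
  (0 < z)%N -> (p %| lucas P Q z)%Z ->
  (forall r, (0 < r)%N -> (r < z)%N -> ~~ (p %| lucas P Q r)%Z) ->
  [/\ n = z -> M = logn p `|lucas P Q z|,
      n = (p * z)%N ->
        M = (logn p `|lucas P Q (p * z)|)%:Z - (logn p `|lucas P Q z|)%:Z,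
      forall k, n = (p ^ k.+2 * z)%N -> M = 1
    & (forall k, n <> (p ^ k * z)%N) -> M = 0].
Proof.
move=> pQ z0 pz zmin.
have fF k m : ~~ (p %| m)%N -> (logn p `|lucas P Q (z * (p ^ k * m))|)%:Z
    = logn p `|lucas P Q (z * p ^ k)|.
  by move=> pm; rewrite logn_lucas_rank.
have f0 d : ~~ (z %| d)%N -> (logn p `|lucas P Q d|)%:Z = 0.
  by rewrite -(dvdz_lucas_rank pp pQ z0 pz zmin) => pd; rewrite logz_eq0.
have [F0 FS Fn] := moebius_transform_ppart pp z0 n0 fF f0.
split=> [nz|npz|k nE|nE].
- by rewrite F0 // muln1.
- by rewrite (FS 0%N) ?expn1 ?expn0 ?muln1 // mulnC.
- rewrite (FS k.+1); last by rewrite mulnC.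
  by rewrite logn_lucas_rankS // intS addrK.
by apply: Fn => k; rewrite mulnC.
Qed.

End Coprime.

(** Scaling adds (d - 1) a to the valuation at d; the functions d and 1 transform to phi(n) and the
    indicator of n = 1. *)
Lemma moebius_transform_smallP (P Q s : int) (p a n : nat) : prime p ->
  (0 < n)%N -> s != 0 -> logn p `|s| = a ->
  (forall d, (0 < d)%N -> lucas P Q d != 0) ->
  moebius_transform
    (fun d => (logn p `|lucas (s * P) (s ^+ 2 * Q) d|)%:Z) n
  = (totient n)%:Z * a%:Z - (n == 1%N)%:R * a%:Z
    + moebius_transform (fun d => (logn p `|lucas P Q d|)%:Z) n.
Proof.
move=> pp n0 s0 sa U0.
rewrite -moebius_transform_id // -moebius_transform_1 // -mulrBl.
rewrite [X in X + _]mulrC -[- moebius_transform _ _]mulN1r.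
rewrite -moebius_transformZ -moebius_transformD -moebius_transformZ.
rewrite -moebius_transformD; apply: eq_moebius_transform => // -[//|d] _.
rewrite lucas_scale lognzM ?expf_neq0 ?U0 // abszX lognX sa; lia.
Qed.

(** * Assembly of the cases (a) to (e) from the transforms *)

Theorem theorem2p2 (P Q : int) (hP : P != 0) (hQ : Q != 0)
    (hD : lucas_disc P Q != 0) (hnd : lucas_nondegenerate P Q)
    (p : nat) (hp : prime p) (n : nat) (hn : (0 < n)%N) :
  let U := lucasU P Q in
  let D := lucas_disc P Q in
  let MU := moebius_dual U in
  let z := entry_point U p in
  (~~ (p%:Z %| gcdz P Q)%Z ->
    [/\ (* (a) *)
        (p%:Z %| Q)%Z -> vp p (MU n) = 0,
        (* (b) *)
        (p%:Z %| D)%Z ->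
        [/\ n = p -> vp p (MU n) = vp p (U p)%:Q,
            forall k : nat, (1 < k)%N -> n = (p ^ k)%N -> vp p (MU n) = 1
          & n <> p -> ~ (exists2 k : nat, (1 < k)%N & n = (p ^ k)%N) ->
            vp p (MU n) = 0]
      & (* (c) *)
        ~~ (p%:Z %| Q * D)%Z ->
        [/\ n = z -> vp p (MU n) = vp p (U z)%:Q,
            n = (p * z)%N ->
            vp p (MU n) = vp p (U (p * z)%N)%:Q - vp p (U z)%:Q,
            forall k : nat, (1 < k)%N -> n = (p ^ k * z)%N -> vp p (MU n) = 1
          & n <> z -> n <> (p * z)%N ->
            ~ (exists2 k : nat, (1 < k)%N & n = (p ^ k * z)%N) ->
            vp p (MU n) = 0]])
  /\
  ((p%:Z %| gcdz P Q)%Z ->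
    (* (d) *)
    (2 * vp p P%:Q <= vp p Q%:Q ->
      (n = 1%N -> vp p (MU n) = 0) /\
      ((1 < n)%N ->
        vp p (MU n) = (totient n)%:Z * vp p P%:Q
                      + vp p (moebius_dual (lucasU_red p P Q) n)))
    /\
    (* (e) *)
    (vp p Q%:Q < 2 * vp p P%:Q ->
      let exceptional :=
        [/\ 2 * vp p P%:Q = vp p Q%:Q + 1, p = 2%N \/ p = 3%N
          & n = (2 * p)%N] in
      (~ exceptional ->
        [/\ n = 2%N -> vp p (MU n) = vp p P%:Q,
            forall k : nat, (1 <= k)%N -> n = (2 * p ^ k)%N ->
            vp p (MU n) = (totient n %/ 2)%N%:Z * vp p Q%:Q + 1
          & n <> 2%N ->
            ~ (exists2 k : nat, (1 <= k)%N & n = (2 * p ^ k)%N) ->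
            vp p (MU n) = (totient n %/ 2)%N%:Z * vp p Q%:Q])
      /\
      (exceptional ->
        vp p (MU (2 * p)%N)
          = vp p Q%:Q + 1 + vp p (pfree p P ^+ 2 - pfree p Q)%:Q))).
Proof.
move=> U D MU z; have p_neq0 : p%:Z != 0 by have := prime_gt0 hp; clear; lia.
have UE d : U d = lucas P Q d by rewrite /U lucasUE.
have U_neq0 d : (0 < d)%N -> lucas P Q d != 0 by rewrite -UE => /hnd[].
have MUE k : (0 < k)%N -> vp p (MU k)
    = moebius_transform (fun d => (logn p `|lucas P Q d|)%:Z) k.
  move=> k0; rewrite vp_moebius_dual // => [|d d0]; last by rewrite UE U_neq0.
  by apply: eq_moebius_transform => // d _; rewrite UE.
rewrite !vp_int dvdz_gcd; split=> [|/andP[pP pQ]].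
  rewrite negb_and => pPQ; split=> [pQ|pD|pQD].
  - by rewrite MUE // moebius_transform_dvdQ //; rewrite pQ orbF in pPQ.
  (* If p divided Q and D = P^2 - 4Q, it would divide P and so gcd(P, Q). *)
  - have pQ : ~~ (p %| Q)%Z.
      apply/negP => pQ; move: pPQ; rewrite pQ orbF => /negP; apply.
      move: pD; rewrite (@dvdz_congr _ _ (P ^+ 2)) ?Euclid_dvdzX //.
        by case/andP.
      by rewrite /D /lucas_disc addrAC subrr add0r rpredN dvdz_mull.
    have [Mp Mk M0] := moebius_transform_disc hp hn U_neq0 pQ pD.
    rewrite MUE //; split=> [/Mp ->|[|[|k]] // _ /Mk -> //|np nk].
    + by rewrite UE.
    + apply: M0 => -[|k]; first by rewrite expn1.
      by move=> nE; apply: nk; exists k.+2.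
  move: pQD; rewrite Euclid_dvdzM // negb_or => /andP[pQ _].
  rewrite !UE MUE //.
  rewrite {}/z; case: (entry_pointP U p) => [z z0 pz zmin|noz].
    rewrite UE in pz.
    have {}zmin r : (0 < r)%N -> (r < z)%N -> ~~ (p %| lucas P Q r)%Z.
      by rewrite -UE; apply: zmin.
    have [Mz Mpz Mk M0] := moebius_transform_rank hp hn U_neq0 pQ z0 pz zmin.
    split=> // [[|[|k]] // _ /Mk -> //|nz npz nk].
    apply: M0 => -[|[|k]]; rewrite ?mul1n ?expn1 //.
    by move=> nE; apply: nk; exists k.+2.
  (* With the default z = 0, the clauses n = z, p z, p^k z contradict n > 0; in the last clause p
     divides no term of positive index. *)
  split=> [nz|nz|k _ nz|_ _ _]; try by move: hn; rewrite nz ?muln0.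
  apply: moebius_transform_0 => // d /noz; rewrite UE => pd.
  by rewrite logz_eq0.
set a := logn p `|P|; set b := logn p `|Q|.
have PE : pfree p P * p%:Z ^+ a = P by have := pfreeK p P; rewrite PoszX.
have QE : pfree p Q * p%:Z ^+ b = Q by have := pfreeK p Q; rewrite PoszX.
split=> [a2b|b2a].
  have {}a2b : (2 * a <= b)%N by move: a2b; clear; lia.
  split=> [n1|n1]; first by rewrite n1 MUE // /moebius_transform big_seq1 logn1.
  set Q' := (Q %/ (p ^ (2 * a))%:Z)%Z.
  have Q'E : (p%:Z ^+ a) ^+ 2 * Q' = Q.
    rewrite -exprM [(a * 2)%N]mulnC -[p%:Z ^+ _]PoszX mulrC; apply: divzK.
    by rewrite dvdzE /= pfactor_dvdn // absz_gt0.
  have P'E : p%:Z ^+ a * pfree p P = P by rewrite mulrC.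
  (* D is p^(2a) times the reduced discriminant; its nonvanishing identifies the reduced [lucasU]
     with [lucas]. *)
  have D'0 : lucas_disc (pfree p P) Q' != 0.
    apply: contraNneq hD => D'0; apply/eqP; rewrite -P'E -Q'E.
    transitivity ((p%:Z ^+ a) ^+ 2 * lucas_disc (pfree p P) Q').
      by rewrite /lucas_disc; ring.
    by rewrite D'0 mulr0.
  have U'0 d : (0 < d)%N -> lucas (pfree p P) Q' d != 0.
    case: d => // d _; have := @U_neq0 d.+1 isT.
    by rewrite -{1}P'E -{1}Q'E lucas_scale mulf_eq0 negb_or => /andP[].
  have U'E d : lucasU_red p P Q d = lucas (pfree p P) Q' d.
    by rewrite /lucasU_red lucasUE.
  rewrite MUE // vp_moebius_dual // => [|d d0]; last by rewrite U'E U'0.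
  rewrite -{1}P'E -{1}Q'E (@moebius_transform_smallP _ _ _ p a) ?expf_neq0 //.
    rewrite gtn_eqF // mul0r subr0; congr (_ + _).
    by apply: eq_moebius_transform => // d _; rewrite U'E.
  by rewrite abszX /= pfactorK.
have {}b2a : (b < 2 * a)%N by move: b2a; clear; lia.
have pr := Ndvdz_pfree hp hP; have pq := Ndvdz_pfree hp hQ.
have V_neq0 d : (0 < d)%N ->
    lucas (pfree p P * p%:Z ^+ a) (pfree p Q * p%:Z ^+ b) d != 0.
  by rewrite PE QE; apply: U_neq0.
have large := moebius_transform_largeP hp pr pq b2a V_neq0.
have generic := logn_lucas_p_generic (pfree p P) hp pq b2a.
have excl := logn_lucas_p_exceptional hp pr pq b2a V_neq0.
rewrite PE QE in large; move=> exc; split=> [nexc|[ab p23 nE]].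
  rewrite MUE //; have [M2 M2p Mk M0] := large n hn.
  split=> [n2|[|[|k]] // _ nE|n2 nk].
  - by rewrite M2 // n2.
  - rewrite expn1 in nE; rewrite M2p // generic // => -[ab p23].
    by apply: nexc; split=> //; move: ab; clear; lia.
  - by rewrite (Mk _ nE).
  apply: M0 => -[|k]; first by rewrite muln1.
  by move=> nE; apply: nk; exists k.+1.
have n0 : (0 < 2 * p)%N by exact: leq_trans (prime_gt0 hp) (leq_pmull _ _).
have [_ M2p _ _] := large _ n0; rewrite MUE // M2p // excl //; last first.
  by move: ab; clear; lia.
(* For n = 2p with p = 2 or 3, phi(n) = 2, so the multiple of v_p(Q) is v_p(Q) itself. *)
rewrite PoszD addrA; congr (_ + _ + _).
by case: p23 => ->; rewrite mul1r.
Qed.
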